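(* $L_m(\mathbf{BRecMAJ}_3^2) \geq 20$.
   Context: $\mathbf{MAJ}_3$ is the 3-bit majority function (outputs $1$ iff at least two inputs are $1$). The balanced recursive ternary majority functions $\mathbf{BRecMAJ}_3^h:\{0,1\}^{3^h}\to\{0,1\}$ are defined by $\mathbf{BRecMAJ}_3^1=\mathbf{MAJ}_3$ and, for $h\ge2$, $\mathbf{BRecMAJ}_3^h(x_1,\dots,x_{3^h}) = \mathbf{MAJ}_3(\mathbf{BRecMAJ}_3^{h-1}(x_1,\dots,x_{3^{h-1}}), \mathbf{BRecMAJ}_3^{h-1}(x_{3^{h-1}+1},\dots,x_{2\cdot 3^{h-1}}), \mathbf{BRecMAJ}_3^{h-1}(x_{2\cdot3^{h-1}+1},\dots,x_{3^h}))$. Thus $\mathbf{BRecMAJ}_3^2(x_1,\dots,x_9)=\mathbf{MAJ}_3(\mathbf{MAJ}_3(x_1,x_2,x_3),\mathbf{MAJ}_3(x_4,x_5,x_6),\mathbf{MAJ}_3(x_7,x_8,x_9))$. A monotone formula is a binary tree whose leaves are labeled by (unnegated) variables and whose internal nodes are labeled by $\wedge$ or $\vee$; its size is its number of leaves. $L_m(f)$ is the minimum size of a monotone formula computing $f$. *)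

(* Defs.v *)
From mathcomp Require Import all_boot.
From mathcomp Require Import boolp.

Set Implicit Arguments.
Unset Strict Implicit.
Unset Printing Implicit Defensive.

Definition MAJ3 (x : 3.-tuple bool) : bool := 2 <= count id x.

(* The k-th (k = 0, 1, 2) third of x.  All indices are in range for k < 3, so
   the default value of nth is never used there. *)
Definition third h (k : nat) (x : (3 ^ h.+1).-tuple bool) :
    (3 ^ h).-tuple bool :=
  [tuple nth false x (k * 3 ^ h + i) | i < 3 ^ h].

(* The recursion starts from the identity of a single bit at h = 0, which gives
   MAJ3 at h = 1: see BRecMAJ3_1. *)
Fixpoint BRecMAJ3 (h : nat) : (3 ^ h).-tuple bool -> bool :=
  match h with
  | 0 => fun x => tnth x ord0
  | h'.+1 => fun x => MAJ3 [tuple @BRecMAJ3 h' (third 0 x);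
                                  @BRecMAJ3 h' (third 1 x);
                                  @BRecMAJ3 h' (third 2 x)]
  end.

Arguments BRecMAJ3 h x : clear implicits.

Lemma nth_third h k (x : (3 ^ h.+1).-tuple bool) i :
  i < 3 ^ h -> nth false (third k x) i = nth false x (k * 3 ^ h + i).
Proof. by move=> lt_i; exact: (nth_mktuple _ false (Ordinal lt_i)). Qed.

Lemma BRecMAJ3_1 (x : 3.-tuple bool) : BRecMAJ3 1 x = MAJ3 x.
Proof.
rewrite /BRecMAJ3 !(tnth_nth false) !nth_third //.
by case: x => [[|a [|b [|c []]]]].
Qed.

Lemma BRecMAJ3_2 (x1 x2 x3 x4 x5 x6 x7 x8 x9 : bool) :
  BRecMAJ3 2 [tuple x1; x2; x3; x4; x5; x6; x7; x8; x9] =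
  MAJ3 [tuple MAJ3 [tuple x1; x2; x3]; MAJ3 [tuple x4; x5; x6];
              MAJ3 [tuple x7; x8; x9]].
Proof. by rewrite /BRecMAJ3 !(tnth_nth false) !nth_third. Qed.

Inductive mformula (n : nat) : Type :=
| MVar of 'I_n
| MAnd of mformula n & mformula n
| MOr of mformula n & mformula n.

Fixpoint mf_eval n (phi : mformula n) (x : n.-tuple bool) : bool :=
  match phi with
  | MVar i => tnth x i
  | MAnd a b => mf_eval a x && mf_eval b x
  | MOr a b => mf_eval a x || mf_eval b x
  end.

Fixpoint mf_size n (phi : mformula n) : nat :=
  match phi with
  | MVar _ => 1
  | MAnd a b | MOr a b => mf_size a + mf_size b
  end.

Definition computes n (phi : mformula n) (f : n.-tuple bool -> bool) : Prop :=
  forall x, mf_eval phi x = f x.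

Definition has_mformula n (f : n.-tuple bool -> bool) : pred nat :=
  fun s => `[< exists2 phi : mformula n, computes phi f & mf_size phi = s >].

(* If no monotone formula computes f (f not monotone, or constant), Lm f is 0,
   so a positive lower bound on Lm f also asserts that f has such a formula. *)
Definition Lm n (f : n.-tuple bool -> bool) : nat :=
  if pselect (exists s, has_mformula f s) is left ex_s then ex_minn ex_s else 0.

Lemma Lm_le n (f : n.-tuple bool -> bool) (phi : mformula n) :
  computes phi f -> Lm f <= mf_size phi.
Proof.
move=> cphi; rewrite /Lm; case: pselect => // ex_s.
by case: ex_minnP => s _; apply; apply/asboolP; exists phi.
Qed.

Lemma Lm_attained n (f : n.-tuple bool -> bool) (phi : mformula n) :
  computes phi f -> exists2 psi : mformula n, computes psi f & mf_size psi = Lm f.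
Proof.
move=> cphi; rewrite /Lm; case: pselect => [ex_s|[]].
  by case: ex_minnP => s /asboolP.
by exists (mf_size phi); apply/asboolP; exists phi.
Qed.

(* Main.v *)
(* The leaves of a monotone formula partition (minterms) x (maxterms) into
   rectangles, each of them monochromatic for one variable.  Following
   Karchmer-Kushilevitz-Nisan, weight the cells so that every leaf rectangle
   has small total weight; following Ueno, strengthen this linear program by
   clique constraints: among pairwise intersecting rectangles at most one is a
   leaf, so a rectangle may exceed the bound by the total price of the cliques
   to which it belongs.

   A cell (x, y) has weight 4 when x and y share exactly one block and omit
   different positions in it, and weight -6 when x = y.  A leaf rectangle has
   weight at most 36 plus its cliques' prices, the prices add up to 432 and the
   weights to 27 * (48 - 6), so 36 * size >= 27 * 42 - 432 = 702 and
   size >= 19.5.  The weights and prices are 36 times an optimal solution of the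
   dual linear program with these cliques. *)

Require Import Defs.
From mathcomp Require Import all_boot.
From mathcomp Require Import zify.

Set Implicit Arguments.
Unset Strict Implicit.
Unset Printing Implicit Defensive.

(** * Finite checks and majorities among three points *)

Lemma all_ord3 (P : 'I_3 -> Prop) :
  P ord0 -> P (Ordinal (isT : 1 < 3)) -> P ord_max -> forall t, P t.
Proof.
by move=> P0 P1 P2 [[|[|[|]]] lt] //; [move: P0 | move: P1 | move: P2];
  congr P; apply: val_inj.
Qed.

Definition majority (T : finType) (f : 'I_3 -> T) (A : {set T}) : bool :=
  1 < #|[set r | f r \in A]|.

Lemma majorityS (T : finType) (f : 'I_3 -> T) (A B : {set T}) :
  A \subset B -> majority f A -> majority f B.
Proof.
move=> /subsetP sAB maj; apply: leq_trans maj _; apply: subset_leq_card.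
by apply/subsetP => r; rewrite !inE => /sAB.
Qed.

(** Two pairs of indices among three always share an index. *)
Lemma majority_disjoint (T : finType) (f : 'I_3 -> T) (A B : {set T}) :
  [disjoint A & B] -> majority f A -> majority f B -> False.
Proof.
rewrite /majority -setI_eq0 => /eqP AB0 majA majB.
have := cardsUI [set r | f r \in A] [set r | f r \in B].
have -> : [set r | f r \in A] :&: [set r | f r \in B] = set0.
  by apply/setP => r; rewrite !inE -in_setI AB0 inE.
have := max_card [set r | f r \in A :|: B].
have -> : [set r | f r \in A :|: B]
  = [set r | f r \in A] :|: [set r | f r \in B].
  by apply/setP => r; rewrite !inE.
by rewrite card_ord cards0; lia.
Qed.

Lemma majority_pair (T : finType) (f : 'I_3 -> T) (A : {set T}) r r' :
  r != r' -> f r \in A -> f r' \in A -> majority f A.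
Proof.
move=> neq Ar Ar'.
suff /subset_leq_card : [set r; r'] \subset [set r | f r \in A].
  by rewrite cards2 neq; apply: leq_trans.
by apply/subsetP => q; rewrite !inE => /orP[]/eqP ->.
Qed.

(** * Rectangle sums and induction on the formula *)

Definition hit (X Y K : finType) (xs : K -> 'I_3 -> X) (ys : K -> 'I_3 -> Y)
    (A : {set X}) (B : {set Y}) (k : K) : bool :=
  majority (xs k) A && majority (ys k) B.

Definition rect_sum (X Y : finType) (w : X -> Y -> nat)
    (A : {set X}) (B : {set Y}) : nat :=
  \sum_(x in A) \sum_(y in B) w x y.

Lemma rect_sum_splitl (X Y : finType) (w : X -> Y -> nat) (C A : {set X}) B :
  rect_sum w A B = rect_sum w (A :&: C) B + rect_sum w (A :\: C) B.
Proof. by rewrite /rect_sum (big_setID C). Qed.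

Lemma rect_sum_splitr (X Y : finType) (w : X -> Y -> nat) A (C B : {set Y}) :
  rect_sum w A B = rect_sum w A (B :&: C) + rect_sum w A (B :\: C).
Proof.
by rewrite /rect_sum -big_split; apply: eq_bigr => x _; rewrite (big_setID C).
Qed.

Lemma disjointID (T : finType) (A C : {set T}) : [disjoint A :&: C & A :\: C].
Proof.
by rewrite -setI_eq0; apply/eqP/setP => x; rewrite !inE;
  case: (x \in C); rewrite ?andbF.
Qed.

Lemma sum_disjointU (K : finType) (c : K -> nat) (S1 S2 : {set K}) :
  (forall k, k \in S1 -> k \in S2 -> False) ->
  \sum_(k in S1 :|: S2) c k = \sum_(k in S1) c k + \sum_(k in S2) c k.
Proof.
move=> dS; rewrite -bigU /=; first by apply: eq_bigl => k; rewrite !inE.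
rewrite -setI_eq0; apply/eqP/setP => k; rewrite !inE.
by apply/negP => /andP[k1 k2]; exact: dS k1 k2.
Qed.

(* A family of pairwise intersecting rectangles: two disjoint sub-rectangles of
   A x B cannot both contain two of the three rows of [xs k] and two of the
   three columns of [ys k].  So the sets S obtained for the two subformulas of a
   gate are disjoint, and no clique is paid for twice. *)
Lemma rect_bound n (X Y K : finType) (ones : X -> n.-tuple bool)
    (zeros : Y -> n.-tuple bool) (gain loss : X -> Y -> nat) (d : nat)
    (c : K -> nat) (xs : K -> 'I_3 -> X) (ys : K -> 'I_3 -> Y) :
  (forall i (A : {set X}) (B : {set Y}),
     {in A, forall x, tnth (ones x) i} ->
     {in B, forall y, ~~ tnth (zeros y) i} ->
     rect_sum gain A B <=
       d + rect_sum loss A B + \sum_(k | hit xs ys A B k) c k) ->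
  forall (phi : mformula n) (A : {set X}) (B : {set Y}),
    {in A, forall x, mf_eval phi (ones x)} ->
    {in B, forall y, ~~ mf_eval phi (zeros y)} ->
  exists2 S : {set K}, {in S, forall k, hit xs ys A B k} &
    rect_sum gain A B <=
      d * mf_size phi + rect_sum loss A B + \sum_(k in S) c k.
Proof.
move=> leaf; elim=> [i|f IHf g IHg|f IHf g IHg] A B Aphi Bphi /=.
- exists [set k | hit xs ys A B k]; first by move=> k; rewrite inE.
  rewrite muln1 (eq_bigl (hit xs ys A B)) => [|k]; last by rewrite inE.
  exact: (leaf i A B Aphi Bphi).
(* A conjunction splits the columns: [f] takes those it rejects, and [g] must reject the others. A
   disjunction dually splits the rows. *)
- pose C := [set y | ~~ mf_eval f (zeros y)].
  have [||S1 S1hit le1] := IHf A (B :&: C).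
  + by move=> x /Aphi /= /andP[].
  + by move=> y; rewrite !inE => /andP[].
  have [||S2 S2hit le2] := IHg A (B :\: C).
  + by move=> x /Aphi /= /andP[].
  + by move=> y; rewrite !inE negbK => /andP[fy /Bphi /=]; rewrite fy.
  exists (S1 :|: S2).
    move=> k; rewrite inE => /orP[/S1hit|/S2hit] /andP[hx hy];
      rewrite /hit hx /=; apply: majorityS hy.
    + exact: subsetIl.
    + exact: subsetDl.
  rewrite sum_disjointU.
    by rewrite !(rect_sum_splitr _ A C B); lia.
  move=> k /S1hit /andP[_ h1] /S2hit /andP[_ h2].
  exact: majority_disjoint (disjointID B C) h1 h2.
- pose C := [set x | mf_eval f (ones x)].
  have [||S1 S1hit le1] := IHf (A :&: C) B.
  + by move=> x; rewrite !inE => /andP[].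
  + by move=> y /Bphi /=; rewrite negb_or => /andP[].
  have [||S2 S2hit le2] := IHg (A :\: C) B.
  + by move=> x; rewrite !inE => /andP[/negbTE fx /Aphi /=]; rewrite fx.
  + by move=> y /Bphi /=; rewrite negb_or => /andP[].
  exists (S1 :|: S2).
    move=> k; rewrite inE => /orP[/S1hit|/S2hit] /andP[hx hy];
      rewrite /hit hy andbT; apply: majorityS hx.
    + exact: subsetIl.
    + exact: subsetDl.
  rewrite sum_disjointU.
    by rewrite !(rect_sum_splitl _ C A B); lia.
  move=> k /S1hit /andP[h1 _] /S2hit /andP[h2 _].
  exact: majority_disjoint (disjointID A C) h1 h2.
Qed.

(** * The numerical inequality at a leaf *)

(** Bounds from below the unequal pairs in a product of an [m]-set and an [n]-set: at most
    [minn m n] pairs are equal. *)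
Definition offdiag (m n : nat) : nat := m * n - minn m n.

(** In order: gain, leaf bound, loss, inner prices, outer prices. The truncated [m + n - 3] bounds
    from below the intersection of two subsets of a 3-set. *)
Definition count_ineq (a00 a01 a10 a11 b00 b01 b10 b11 : nat) : bool :=
  4 * (a00 * b11 + a01 * b10 + a10 * b01 + a11 * b00) <=
  36 + 6 * ((a11 + b11 - 3) + (a10 + b10 - 3)
            + ((a01 + b01 - 3) + (a00 + b00 - 3)))
  + (4 * ((a00 + a10 - 3) * (b01 + b11 - 3)
          + (a01 + a11 - 3) * (b00 + b10 - 3))
  + (offdiag a00 b10 * offdiag a01 b11 + offdiag a10 b00 * offdiag a11 b01)).

(* The inequality at a leaf, in terms of slice cardinalities only; a_ps and b_ps
   stand for [#|slice b j A p s|] and [#|slice b j B p s|]. *)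
Lemma count_ineq_le3 a00 a01 a10 a11 b00 b01 b10 b11 :
  a00 <= 3 -> a01 <= 3 -> a10 <= 3 -> a11 <= 3 ->
  b00 <= 3 -> b01 <= 3 -> b10 <= 3 -> b11 <= 3 ->
  count_ineq a00 a01 a10 a11 b00 b01 b10 b11.
Proof.
pose r := iota 0 4.
have mem_r k : k <= 3 -> k \in r by rewrite mem_iota.
have /allP check :
    all (fun a00 => all (fun a01 => all (fun a10 => all (fun a11 =>
    all (fun b00 => all (fun b01 => all (fun b10 => all (fun b11 =>
      count_ineq a00 a01 a10 a11 b00 b01 b10 b11) r) r) r) r) r) r) r) r.
  by vm_compute.
move=> /mem_r h1 /mem_r h2 /mem_r h3 /mem_r h4.
move=> /mem_r h5 /mem_r h6 /mem_r h7 /mem_r h8.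
move: (check _ h1) => /allP/(_ _ h2)/allP/(_ _ h3)/allP/(_ _ h4)/allP/(_ _ h5).
by move=> /allP/(_ _ h6)/allP/(_ _ h7)/allP/(_ _ h8).
Qed.

(** * Minterms, maxterms and cell weights *)

(* (t, v, w) encodes the minterm that leaves block t empty and omits position v
   of block t + 1 and position w of block t + 2 (mod 3).  The function is
   self-dual, so the complements of the minterms are its maxterms. *)
Definition code : finType := ('I_3 * 'I_3 * 'I_3)%type.

Definition bit (x : code) (i : nat) : bool :=
  let: (t, v, w) := x in
  (i %/ 3 != t) && (i %% 3 != if i %/ 3 == ordS t then v else w).

Definition minterm (x : code) : (3 ^ 2).-tuple bool :=
  [tuple bit x i | i < 3 ^ 2].

Definition maxterm (y : code) : (3 ^ 2).-tuple bool :=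
  [tuple ~~ bit y i | i < 3 ^ 2].

Definition maj (a b c : bool) : bool := a && b || c && (a || b).

Lemma MAJ3E a b c : MAJ3 [tuple a; b; c] = maj a b c.
Proof. by case: a; case: b; case: c. Qed.

Lemma BRecMAJ3_2E (x : (3 ^ 2).-tuple bool) :
  let n := nth false x in
  BRecMAJ3 2 x = maj (maj (n 0) (n 1) (n 2)) (maj (n 3) (n 4) (n 5))
                     (maj (n 6) (n 7) (n 8)).
Proof.
case: x => [[|x1[|x2[|x3[|x4[|x5[|x6[|x7[|x8[|x9[]]]]]]]]]] // sz].
move=> n; rewrite -!MAJ3E -BRecMAJ3_2 /n; congr (BRecMAJ3 2 _); exact: val_inj.
Qed.

Lemma BRecMAJ3_minterm x : BRecMAJ3 2 (minterm x).
Proof.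
rewrite BRecMAJ3_2E.
have nE i (lt9 : i < 3 ^ 2) : nth false (minterm x) i = bit x i.
  by rewrite (nth_mktuple _ false (Ordinal lt9)).
rewrite !nE //; case: x {nE} => [[t v] w].
by move: t v w; do 3!apply: all_ord3.
Qed.

Lemma BRecMAJ3_maxterm y : ~~ BRecMAJ3 2 (maxterm y).
Proof.
rewrite BRecMAJ3_2E.
have nE i (lt9 : i < 3 ^ 2) : nth false (maxterm y) i = ~~ bit y i.
  by rewrite (nth_mktuple _ false (Ordinal lt9)).
rewrite !nE //; case: y {nE} => [[t v] w].
by move: t v w; do 3!apply: all_ord3.
Qed.

(* The minterm using block b, where it omits position r, and one other block,
   chosen by s, where it omits u. *)
Definition code_at (b : 'I_3) (s : bool) (u r : 'I_3) : code :=
  if s then (ord_pred b, r, u) else (ordS b, u, r).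

Definition other (p : bool) (j : 'I_3) : 'I_3 :=
  if p then ordS j else ord_pred j.

(* Parametrizes the twelve minterms that contain variable 3 b + j. *)
Definition leaf_code (b j : 'I_3) (q : bool * bool * 'I_3) : code :=
  code_at b q.1.2 q.2 (other q.1.1 j).

(** The positive part of the weight; [loss] is the negative part, kept apart so that all sums stay
    in [nat]. *)
Definition gain (x y : code) : nat :=
  let: (t, v, w) := x in let: (t', v', w') := y in
  4 * ((t' == ordS t) && (w != v') || (t == ordS t') && (v != w')).

Definition loss (x y : code) : nat := 6 * (x == y).

Lemma other_neq j : other false j != other true j.
Proof. by move: j; apply: all_ord3. Qed.

Lemma gain_leaf_code b j p s u p' s' u' :
  gain (leaf_code b j (p, s, u)) (leaf_code b j (p', s', u'))
  = 4 * ((p != p') && (s != s')).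
Proof.
by case: s; case: s'; case: p; case: p'; move: b j u u'; do 4!apply: all_ord3.
Qed.

Lemma leaf_code_inj b j : injective (leaf_code b j).
Proof.
move=> [[p s] u] [[p' s'] u'] /eqP eq; apply/eqP; move: eq; apply/implyP.
by case: s; case: s'; case: p; case: p'; move: b j u u'; do 4!apply: all_ord3.
Qed.

Lemma leaf_codeP (b j : 'I_3) x :
  bit x (b * 3 + j) -> exists q, x = leaf_code b j q.
Proof.
move: x => [[t v] w] bx.
(* Block [b] is used, so the empty block is one of the other two, which decides [s]; the position
   omitted in [b] is not [j], which leaves two values for [p]. *)
exists (if t == ordS b then (w == ordS j, false, v)
        else (v == ordS j, true, w)).
apply/eqP; move: bx; apply/implyP.
by move: b j t v w; do 5!apply: all_ord3.
Qed.

Lemma sum_ord3 (F : 'I_3 -> nat) :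
  \sum_t F t = F ord0 + F (Ordinal (isT : 1 < 3)) + F ord_max.
Proof.
rewrite !big_ord_recl big_ord0 addn0 addnA.
by congr (_ + F _ + F _); apply: val_inj.
Qed.

Lemma sum_code (F : code -> nat) :
  \sum_x F x = \sum_t \sum_v \sum_w F (t, v, w).
Proof. by rewrite !pair_big /=; apply: eq_bigr => [[[t v] w]]. Qed.

Lemma card_code : #|code| = 27.
Proof. by rewrite !card_prod card_ord. Qed.

(** Two empty blocks for [y], two omissions in the shared block and three in the other give 12 cells
    of weight 4. *)
Lemma sum_gain x : \sum_y gain x y = 48.
Proof.
case: x => [[t v] w]; rewrite sum_code sum_ord3 !sum_ord3.
by move: t v w; do 3!apply: all_ord3.
Qed.

Lemma rect_sum_lossE A B : rect_sum loss A B = 6 * #|A :&: B|.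
Proof.
rewrite /rect_sum (big_setID B) /= [X in _ + X]big1 => [|x]; last first.
  rewrite inE => /andP[xB _]; apply: big1 => y yB; rewrite /loss.
  by case: eqP => // xy; rewrite xy yB in xB.
rewrite addn0 mulnC -sum_nat_const.
apply: eq_bigr => x; rewrite inE => /andP[_ xB].
rewrite (bigD1 x) //= big1 /loss ?eqxx // => y /andP[_ /negbTE].
by rewrite eq_sym => ->.
Qed.

(** By [gain_leaf_code] the gain is constant on a product of slices, so only their cardinalities
    matter for it. *)
Definition slice (b j : 'I_3) (A : {set code}) (p s : bool) : {set 'I_3} :=
  [set u | leaf_code b j (p, s, u) \in A].

Lemma sum_slices (b j : 'I_3) (A : {set code}) (F : code -> nat) :
  {in A, forall x, bit x (b * 3 + j)} ->
  \sum_(x in A) F x =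
  \sum_(p : bool) \sum_(s : bool) \sum_(u in slice b j A p s)
    F (leaf_code b j (p, s, u)).
Proof.
move=> bA; have -> : A = leaf_code b j @: [set q | leaf_code b j q \in A].
  apply/setP => x; apply/idP/imsetP => [xA|[q + ->]]; last by rewrite inE.
  by have [q xE] := leaf_codeP (bA x xA); exists q; rewrite // inE -xE.
rewrite big_imset /=; last by move=> q q' _ _; exact: leaf_code_inj.
rewrite pair_big pair_big_dep /=.
apply: eq_big => [[[p s] u]|[[p s] u]] //=; rewrite !inE.
by rewrite mem_imset //; [rewrite inE | exact: leaf_code_inj].
Qed.

Lemma leq_sum_inj (I J : finType) (h : I -> J) (P : pred I) (Q : pred J)
    (F : I -> nat) (G : J -> nat) :
  injective h -> (forall i, P i -> Q (h i) /\ F i <= G (h i)) ->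
  \sum_(i | P i) F i <= \sum_(j | Q j) G j.
Proof.
move=> h_inj PQ.
have -> : \sum_(i | P i) F i = \sum_(i in [set i | P i]) F i.
  by apply: eq_bigl => i; rewrite inE.
apply: (@leq_trans (\sum_(j in h @: [set i | P i]) G j)).
  rewrite big_imset => [|i i' _ _]; last exact: h_inj.
  by apply: leq_sum => i; rewrite inE => /PQ[].
rewrite [leqRHS](bigID (mem (h @: [set i | P i]))) /= -[leqLHS]addn0 leq_add //.
rewrite leq_eqVlt; apply/orP; left; apply/eqP; apply: eq_bigl => j.
case: imsetP => [[i + ->]|_]; last by rewrite andbF.
by rewrite inE andbT => /PQ[->].
Qed.

(** * Cliques and their prices *)

(* An inner clique fixes the second block of the rows and that of the columns
   (two different blocks) and plays MAJ3 in block b; an outer clique fixes one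
   omitted position per block, for the rows and for the columns, and plays MAJ3
   on the blocks. *)
Definition inner : finType := ('I_3 * bool * 'I_3 * 'I_3)%type.
Definition outer : finType := ({ffun 'I_3 -> 'I_3} * {ffun 'I_3 -> 'I_3})%type.
Definition clique : finType := (inner + outer)%type.

Definition outer_code (f : {ffun 'I_3 -> 'I_3}) (t : 'I_3) : code :=
  (t, f (ordS t), f (ord_pred t)).

Definition clique_row (k : clique) : 'I_3 -> code :=
  match k with
  | inl (b, s, u, _) => code_at b s u
  | inr (f, _) => outer_code f
  end.

Definition clique_col (k : clique) : 'I_3 -> code :=
  match k with
  | inl (b, s, _, v) => code_at b (~~ s) v
  | inr (_, g) => outer_code g
  end.

Definition clique_weight (k : clique) : nat :=
  match k with
  | inl _ => 4
  | inr (f, g) => \prod_t (f t != g t)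
  end.

(** The 54 inner cliques cost 4 each; each of the 27 functions [f] has 8 functions [g] differing
    from it everywhere. Both kinds total 216. *)
Lemma sum_clique_weight : \sum_k clique_weight k = 432.
Proof.
rewrite big_sumType /= sum_nat_const !card_prod !card_ord card_bool.
have -> : \sum_(k : outer) clique_weight (inr k)
        = \sum_(f : {ffun 'I_3 -> 'I_3}) 8.
  transitivity (\sum_(f : {ffun 'I_3 -> 'I_3}) \sum_(g : {ffun 'I_3 -> 'I_3})
                  clique_weight (inr (f, g))).
    by rewrite pair_big; apply: eq_bigr => [[f g]].
  apply: eq_bigr => f _; rewrite -(bigA_distr_bigA (fun t u => f t != u : nat)).
  have sum_neq : forall i : 'I_3, \sum_(u : 'I_3) (i != u) = 2.
    by apply: all_ord3; rewrite sum_ord3.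
  by under eq_bigr do rewrite sum_neq; rewrite prod_nat_const card_ord.
by rewrite sum_nat_const card_ffun !card_ord.
Qed.

Notation hits := (hit clique_row clique_col).

(** A [u] in both slices with the same [s] puts two of the three rows of an inner clique in [A];
    likewise for columns in [B]. *)
Lemma sum_inner_hits (b j : 'I_3) (A B : {set code}) :
  \sum_(s : bool)
     4 * (#|slice b j A false s :&: slice b j A true s| *
          #|slice b j B false (~~ s) :&: slice b j B true (~~ s)|) <=
  \sum_(k : inner | hits A B (inl k)) clique_weight (inl k).
Proof.
pose U s := slice b j A false s :&: slice b j A true s.
pose V s := slice b j B false (~~ s) :&: slice b j B true (~~ s).
have -> : \sum_(s : bool) 4 * (#|U s| * #|V s|)
        = \sum_(s : bool) \sum_(z in setX (U s) (V s)) 4.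
  by apply: eq_bigr => s _; rewrite sum_nat_const cardsX mulnC.
rewrite pair_big_dep /=.
apply: (@leq_sum_inj _ _ (fun z => (b, z.1, z.2.1, z.2.2) : inner)).
  by move=> [s [u v]] [s' [u' v']] [-> -> ->].
move=> [s [u v]] /=; rewrite !inE /= => /andP[/andP[u0 u1] /andP[v0 v1]].
split=> //; apply/andP; split.
- exact: majority_pair (other_neq j) u0 u1.
- exact: majority_pair (other_neq j) v0 v1.
Qed.

Lemma card_neq_pairs (T : finType) (U V : {set T}) :
  offdiag #|U| #|V| <= #|[set z in setX U V | z.1 != z.2]|.
Proof.
rewrite /offdiag -cardsX -(cardsID [set z | z.1 == z.2]) leq_subLR.
rewrite leq_add //; last first.
  by apply: subset_leq_card; apply/subsetP => z; rewrite !inE andbC.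
have sub : setX U V :&: [set z | z.1 == z.2]
             \subset (fun x => (x, x)) @: (U :&: V).
  apply/subsetP => -[x y]; rewrite !inE /= => /andP[/andP[xU yV] /eqP xy].
  by apply/imsetP; exists x; rewrite -?xy // inE xU xy.
apply: leq_trans (subset_leq_card sub) _.
apply: leq_trans (leq_imset_card _ _) _.
by rewrite leq_min !subset_leq_card ?subsetIl ?subsetIr.
Qed.

Definition choices (b r u0 u1 : 'I_3) : {ffun 'I_3 -> 'I_3} :=
  [ffun t => if t == b then r else if t == ord_pred b then u0 else u1].

Lemma choices_inj b r u0 u1 r' u0' u1' :
  choices b r u0 u1 = choices b r' u0' u1' -> [/\ r = r', u0 = u0' & u1 = u1'].
Proof.
move=> /ffunP eqf; have := (eqf b, eqf (ord_pred b), eqf (ordS b)).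
rewrite !ffunE !eqxx.
have -> : ord_pred b == b = false by move: b {eqf}; apply: all_ord3.
have -> : ordS b == b = false by move: b {eqf}; apply: all_ord3.
have -> : ordS b == ord_pred b = false by move: b {eqf}; apply: all_ord3.
by case=> [[-> ->] ->].
Qed.

Lemma outer_code_choices_ordS b r u0 u1 :
  outer_code (choices b r u0 u1) (ordS b) = code_at b false u0 r.
Proof.
by apply/eqP; rewrite /outer_code !ffunE; move: b r u0 u1; do 4!apply: all_ord3.
Qed.

Lemma outer_code_choices_pred b r u0 u1 :
  outer_code (choices b r u0 u1) (ord_pred b) = code_at b true u1 r.
Proof.
by apply/eqP; rewrite /outer_code !ffunE; move: b r u0 u1; do 4!apply: all_ord3.
Qed.

(** Rows omit [other p j] in block [b] and columns omit the other neighbour of [j]; unequal pairs in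
    the two remaining blocks complete an outer clique of price 1, hit through its two rows and two
    columns that use [b]. *)
Lemma sum_outer_hits (b j : 'I_3) (A B : {set code}) :
  \sum_(p : bool)
     offdiag #|slice b j A p false| #|slice b j B (~~ p) false| *
     offdiag #|slice b j A p true| #|slice b j B (~~ p) true| <=
  \sum_(k : outer | hits A B (inr k)) clique_weight (inr k).
Proof.
pose W p s :=
  [set z in setX (slice b j A p s) (slice b j B (~~ p) s) | z.1 != z.2].
apply: (@leq_trans (\sum_(p : bool) \sum_(z in setX (W p false) (W p true)) 1)).
  by apply: leq_sum => p _; rewrite sum1_card cardsX leq_mul ?card_neq_pairs.
rewrite pair_big_dep /=.
pose h (z : bool * (('I_3 * 'I_3) * ('I_3 * 'I_3))) : outer :=
  (choices b (other z.1 j) z.2.1.1 z.2.2.1,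
   choices b (other (~~ z.1) j) z.2.1.2 z.2.2.2).
have other_inj p p' : other p j = other p' j -> p = p'.
  by have := other_neq j; case: p; case: p' => // /eqP neq eq; case: neq.
apply: (@leq_sum_inj _ _ h).
  move=> [p [[u0 v0] [u1 v1]]] [p' [[u0' v0'] [u1' v1']]].
  by case=> /= /choices_inj[/other_inj -> -> ->] /choices_inj[_ -> ->].
have predS : ordS b != ord_pred b by move: b {W h}; apply: all_ord3.
move=> [p [[u0 v0] [u1 v1]]] /=; rewrite !inE /=.
move=> /andP[/andP[/andP[a0 b0] neq0] /andP[/andP[a1 b1] neq1]].
split; first apply/andP; first split.
- by apply: majority_pair predS _ _;
    rewrite /= ?outer_code_choices_ordS ?outer_code_choices_pred.
- by apply: majority_pair predS _ _;
    rewrite /= ?outer_code_choices_ordS ?outer_code_choices_pred.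
rewrite prodn_gt0 // => t; rewrite !ffunE lt0b.
case: ifP => _; last by case: ifP.
by have := other_neq j; rewrite eq_sym; case: p {a0 b0 a1 b1};
  rewrite // eq_sym.
Qed.

(** * The leaf bound and the conclusion *)

Lemma leaf_bound (b j : 'I_3) (A B : {set code}) :
  {in A, forall x, bit x (b * 3 + j)} -> {in B, forall y, bit y (b * 3 + j)} ->
  rect_sum gain A B <=
    36 + rect_sum loss A B + \sum_(k | hits A B k) clique_weight k.
Proof.
move=> bA bB; have bAB : {in A :&: B, forall x, bit x (b * 3 + j)}.
  by move=> x; rewrite inE => /andP[/bA].
set a := slice b j A; set b' := slice b j B.
have le3 (U : {set 'I_3}) : #|U| <= 3 by have := max_card U; rewrite card_ord.
have := count_ineq_le3 (le3 (a false false)) (le3 (a false true))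
  (le3 (a true false)) (le3 (a true true)) (le3 (b' false false))
  (le3 (b' false true)) (le3 (b' true false)) (le3 (b' true true)).
have -> : rect_sum gain A B = 4 * (#|a false false| * #|b' true true|
  + #|a false true| * #|b' true false| + #|a true false| * #|b' false true|
  + #|a true true| * #|b' false false|).
  rewrite /rect_sum (sum_slices _ bA).
  under eq_bigr do under eq_bigr do under eq_bigr do
    (rewrite (sum_slices _ bB);
     under eq_bigr do under eq_bigr do (under eq_bigr do rewrite gain_leaf_code;
       rewrite sum_nat_const)).
  under eq_bigr do under eq_bigr do rewrite sum_nat_const.
  by rewrite !big_bool /= -/a -/b'; lia.
(* The gain is exact in the slice cardinalities; the loss and the prices need only be bounded from
   below. *)
move=> ineq; apply: leq_trans ineq _.
have leq_cardI (U V : {set 'I_3}) : #|U| + #|V| - 3 <= #|U :&: V|.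
  by have := cardsUI U V; have := le3 (U :|: V); lia.
apply: leq_add; first rewrite leq_add2l rect_sum_lossE leq_mul2l /=.
  rewrite -[#|A :&: B|]sum1_card (sum_slices _ bAB) !big_bool /= !sum1_card.
  have sliceI p s : slice b j (A :&: B) p s = a p s :&: b' p s.
    by apply/setP => u; rewrite !inE.
  rewrite !sliceI.
  by rewrite !leq_add.
rewrite big_sumType; apply: leq_add.
  apply: leq_trans (sum_inner_hits b j A B).
  by rewrite big_bool /= -/a -/b' -mulnDr leq_mul2l /= addnC leq_add // leq_mul.
apply: leq_trans (sum_outer_hits b j A B).
by rewrite big_bool /= addnC.
Qed.

Definition mvar (i : nat) : mformula (3 ^ 2) := MVar (inord i : 'I_9).

Definition mmaj n (f g h : mformula n) : mformula n :=
  MOr (MAnd f g) (MAnd h (MOr f g)).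

Definition mmaj_block (i : nat) : mformula (3 ^ 2) :=
  mmaj (mvar i) (mvar i.+1) (mvar i.+2).

(** Ensures that [Lm] is attained by a formula and is not the default 0. *)
Lemma computes_BRecMAJ3_2 :
  computes (mmaj (mmaj_block 0) (mmaj_block 3) (mmaj_block 6)) (BRecMAJ3 2).
Proof.
have mvarE i x : i < 9 -> mf_eval (mvar i) x = nth false x i.
  by move=> lt9; rewrite /= (tnth_nth false) inordK.
by move=> x; rewrite BRecMAJ3_2E /= -!mvarE.
Qed.

Theorem theorem6p1 : Lm (BRecMAJ3 2) >= 20.
Proof.
have [phi phiP <-] := Lm_attained computes_BRecMAJ3_2.
have [i A B Ai Bi|x _|y _|S _] := @rect_bound _ code code clique minterm
    maxterm gain loss 36 clique_weight clique_row clique_col _ phi setT setT.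
- have lt3 : i %/ 3 < 3 by have := ltn_ord i; rewrite ltn_divLR.
  have lt3' : i %% 3 < 3 by rewrite ltn_mod.
  apply: (@leaf_bound (Ordinal lt3) (Ordinal lt3')) => x /=; rewrite -divn_eq.
  + by move=> /Ai; rewrite tnth_mktuple.
  + by move=> /Bi; rewrite tnth_mktuple negbK.
- by rewrite phiP BRecMAJ3_minterm.
- by rewrite phiP BRecMAJ3_maxterm.
rewrite rect_sum_lossE setTI cardsT card_code.
have -> : rect_sum gain setT setT = 27 * 48.
  rewrite /rect_sum (eq_bigr (fun=> 48)) => [|x _].
    by rewrite sum_nat_const cardsT card_code.
  by rewrite -[RHS](sum_gain x); apply: eq_bigl => y; rewrite inE.
have : \sum_(k in S) clique_weight k <= 432.
  by rewrite -sum_clique_weight [leqRHS](bigID (mem S)) leq_addr.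
by lia.
Qed.
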